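(* Let $k$ be a positive even integer, let $m\in\mathbb{N}$, $m\ge 1$, and put $i=\frac{m}{2}$. Let $q$ be a complex number with $0<|q|<1$, and define $$U_n(q) := q^{\frac{2i-1}{4}}\,\frac{\left(q^{\frac{k-(4i-2)}{4}},\,q^{\frac{3k+(4i-2)}{4}};\,q^{k}\right)_\infty}{\left(q^{\frac{k+(4i-2)}{4}},\,q^{\frac{3k-(4i-2)}{4}};\,q^{k}\right)_\infty}=q^{\frac{2i-1}{4}}\,\frac{f\left(-q^{\frac{k-(4i-2)}{4}},-q^{\frac{3k+(4i-2)}{4}}\right)}{f\left(-q^{\frac{k+(4i-2)}{4}},-q^{\frac{3k-(4i-2)}{4}}\right)},$$ where it is assumed that the numerator and the denominator of this quotient are nonzero. Then $$\frac{1}{U_n(q)}-U_n(q)=\frac{\phi\left(q^{\frac{k}{4}}\right) f\left(-q^{\frac{2i-1}{2}},-q^{\frac{k-(2i-1)}{2}}\right)}{q^{\frac{2i-1}{4}}\,\psi\left(q^{\frac{k}{2}}\right) f\left(-q^{\frac{k-(4i-2)}{4}},-q^{\frac{k+(4i-2)}{4}}\right)}$$ and $$\frac{1}{U_n(q)}+U_n(q)=\frac{\phi\left(-q^{\frac{k}{4}}\right) f\left(q^{\frac{2i-1}{2}},q^{\frac{k-(2i-1)}{2}}\right)}{q^{\frac{2i-1}{4}}\,\psi\left(q^{\frac{k}{2}}\right) f\left(-q^{\frac{k-(4i-2)}{4}},-q^{\frac{k+(4i-2)}{4}}\right)}.$$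
   Context: For complex $\lambda$ and $|q|<1$, $(\lambda;q)_\infty=\prod_{n\ge 0}(1-\lambda q^n)$ and $(\lambda_1,\dots,\lambda_r;q)_\infty=\prod_{j=1}^r(\lambda_j;q)_\infty$. Ramanujan's general theta function is $f(a,b)=\sum_{n=-\infty}^{\infty}a^{n(n+1)/2}b^{n(n-1)/2}$ for $|ab|<1$; by Jacobi's triple product identity $f(a,b)=(-a;ab)_\infty(-b;ab)_\infty(ab;ab)_\infty$. Special cases: $\phi(q)=f(q,q)=\sum_{n=-\infty}^\infty q^{n^2}$ and $\psi(q)=f(q,q^3)=\sum_{n=0}^\infty q^{n(n+1)/2}$. A fourth root $q^{1/4}$ of $q$ is fixed once and for all, and every power $q^{r/4}$ with $r\in\mathbb{Z}$ means $(q^{1/4})^r$. The subscript $n$ in $U_n$ is only a label; the function depends on $k$ and $i$. *)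

(* Defs.v *)
From mathcomp Require Import all_boot all_order all_algebra.
From mathcomp Require Export complex.
From mathcomp Require Import all_classical all_reals all_analysis.

Set Implicit Arguments.
Unset Strict Implicit.
Unset Printing Implicit Defensive.

Import Order.TTheory GRing.Theory Num.Theory numFieldNormedType.Exports.
Local Open Scope ring_scope.

(* Everything is defined over a numFieldType C, whose topology is canonical;
   the intended instance is C = R[i] with R : realType. *)

(* (l; q)_oo *)
Definition qpoch (C : numFieldType) (l q : C) : C :=
  limn (fun N : nat => \prod_(0 <= n < N) (1 - l * q ^+ n)).

(* (l_1, ..., l_r; q)_oo *)
Definition qpochs (C : numFieldType) (ls : seq C) (q : C) : C :=
  \prod_(l <- ls) qpoch l q.

(* n (n + 1) and n (n - 1) are even and nonnegative for every integer n, so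
   the divisions by 2 are exact and no negative power of a or b occurs. *)
Definition theta_term (C : numFieldType) (a b : C) (n : int) : C :=
  a ^ ((n * (n + 1)) %/ 2)%Z * b ^ ((n * (n - 1)) %/ 2)%Z.

(* The bilateral series f(a, b), as the sum over n >= 0 plus the sum over
   n <= -1. *)
Definition theta (C : numFieldType) (a b : C) : C :=
  limn (series (fun n : nat => theta_term a b n%:Z))
  + limn (series (fun n : nat => theta_term a b (- n.+1%:Z))).

Definition phi (C : numFieldType) (q : C) : C := theta q q.

Definition psi (C : numFieldType) (q : C) : C := theta q (q ^+ 3).

(* If q4 is the chosen fourth root of q, then qpow q4 e is q^e for e in
   (1/4)Z: there 4 * e is an integer, hence equal to its numerator. The value
   for other e is meaningless and never used. *)
Definition qpow (C : numFieldType) (q4 : C) (e : rat) : C :=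
  q4 ^ numq (4 * e).

Definition Unum (C : numFieldType) (q4 : C) (k : nat) (i : rat) : C :=
  qpochs [:: qpow q4 ((k%:R - (4 * i - 2)) / 4);
             qpow q4 ((3 * k%:R + (4 * i - 2)) / 4)] (qpow q4 k%:R).

Definition Uden (C : numFieldType) (q4 : C) (k : nat) (i : rat) : C :=
  qpochs [:: qpow q4 ((k%:R + (4 * i - 2)) / 4);
             qpow q4 ((3 * k%:R - (4 * i - 2)) / 4)] (qpow q4 k%:R).

Definition U (C : numFieldType) (q4 : C) (k : nat) (i : rat) : C :=
  qpow q4 ((2 * i - 1) / 4) * (Unum q4 k i / Uden q4 k i).

(* Main.v *)
(* Put p = q^(k/4), w = q^((2i-1)/4), z = w^2, A = f(-p/z, -p^3 z) and
   B = f(-pz, -p^3/z). The triple product gives U = w A / B, so the theorem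
   amounts to
     B^2 - z A^2 = phi(p) f(-z, -p^2/z),
     B^2 + z A^2 = phi(-p) f(z, p^2/z),
     A B = psi(p^2) f(-p/z, -pz).
   Each side is an absolutely convergent sum of signed monomials in p and z
   over Z x Z (over two copies of Z x Z for the left-hand sides of the first
   two), and 2 n^2 + 2 m^2 = (n+m)^2 + (n-m)^2 shows that a bijection of the
   index sets matches the terms: (n, m) goes to (n+m, n-m) in B^2 and to
   (1-n-m, n-m) in z A^2, so that the two copies fill the even and the odd
   half of Z x Z; for A B, n+m is written as 2w or 1-2w, on which
   x^2 - x takes the same values.
   The triple product is the limit of a finite identity with Gaussian binomial
   coefficients. *)

Require Import Defs.
From mathcomp Require Import all_boot all_order all_algebra.
From mathcomp Require Import all_classical all_reals all_analysis.
From mathcomp Require Import ring zify.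
Import Order.TTheory GRing.Theory Num.Theory numFieldNormedType.Exports.
Local Open Scope ring_scope.
Local Open Scope complex_scope.

Set Implicit Arguments.
Unset Strict Implicit.
Unset Printing Implicit Defensive.

(** * Unordered summation over an arbitrary index type *)

(** Convergence along the net of finite subsets, coded as duplicate-free lists. It does not depend
    on an enumeration of [T], so it can be transported along any bijection of index types. *)
Definition hassum (C : numFieldType) (T : eqType) (g : T -> C) (l : C) :=
  forall e : C, 0 < e -> exists s0 : seq T, forall s : seq T,
    uniq s -> {subset s0 <= s} -> `|\sum_(t <- s) g t - l| < e.

Lemma sum_subset (V : nmodType) (T : eqType) (g : T -> V) (s s' : seq T) :
  uniq s -> uniq s' -> {subset s <= s'} ->
  \sum_(t <- s') g t = \sum_(t <- s) g t + \sum_(t <- s' | t \notin s) g t.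
Proof.
move=> us us' ss'; rewrite (bigID (mem s)) /=; congr (_ + _).
rewrite -big_filter; apply/perm_big/uniq_perm; rewrite ?filter_uniq // => x.
by rewrite mem_filter; case: (boolP (x \in s)) => // /ss' ->.
Qed.

Lemma ler_sum_subset (C : numDomainType) (T : eqType) (g : T -> C)
    (s s' : seq T) :
  (forall t, 0 <= g t) -> uniq s -> uniq s' -> {subset s <= s'} ->
  \sum_(t <- s) g t <= \sum_(t <- s') g t.
Proof.
move=> g0 us us' ss'; rewrite (sum_subset g us us' ss') lerDl.
by apply: sumr_ge0.
Qed.

Section Hassum.
Context {C : numFieldType}.
Implicit Types (T : eqType).

Lemma hassum_uniq_witness T (g : T -> C) l : hassum g l ->
  forall e : C, 0 < e -> exists2 s0 : seq T, uniq s0 & forall s : seq T,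
    uniq s -> {subset s0 <= s} -> `|\sum_(t <- s) g t - l| < e.
Proof.
move=> gl e /gl[s0 Hs0]; exists (undup s0); first exact: undup_uniq.
by move=> s us ss; apply: Hs0 => // x; rewrite -mem_undup; apply: ss.
Qed.

Lemma hassum_unique T (g : T -> C) l l' : hassum g l -> hassum g l' -> l = l'.
Proof.
move=> gl gl'; apply/eqP; rewrite -subr_eq0 -normr_eq0; apply/negPn/negP => n0.
have e0 : 0 < `|l - l'| / 2 by rewrite divr_gt0 // lt0r n0 /=.
have [s0 Hs0] := gl _ e0; have [s1 Hs1] := gl' _ e0.
have us := undup_uniq (s0 ++ s1).
have h0 := Hs0 _ us; have h1 := Hs1 _ us.
have /h0 k0 : {subset s0 <= undup (s0 ++ s1)}.
  by move=> x; rewrite mem_undup mem_cat => ->.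
have /h1 k1 : {subset s1 <= undup (s0 ++ s1)}.
  by move=> x; rewrite mem_undup mem_cat orbC => ->.
set S := \sum_(_ <- _) _ in k0 k1.
have := ltrD k0 k1; rewrite -splitr (distrC _ l) => k.
by have := le_lt_trans (ler_distD S l l') k; rewrite ltxx.
Qed.

Lemma eq_hassum T (g g' : T -> C) l : g =1 g' -> hassum g l -> hassum g' l.
Proof.
move=> gg' gl e /gl[s0 H]; exists s0 => s us ss.
under eq_bigr do rewrite -gg'.
exact: H.
Qed.

Lemma hassumZ T (g : T -> C) c l : hassum g l -> hassum (fun t => c * g t) (c * l).
Proof.
have [->|c0] := eqVneq c 0 => gl e e0.
  by exists [::] => s _ _; rewrite mul0r big1 ?subrr ?normr0 // => *; rewrite mul0r.
have c0' : 0 < `|c| by rewrite normr_gt0.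
have [s0 Hs0] := gl _ (divr_gt0 e0 c0').
exists s0 => s us ss; rewrite -mulr_sumr -mulrBr normrM.
by rewrite mulrC -ltr_pdivlMr //; apply: Hs0.
Qed.

Lemma hassum_bij T T' (f : T -> T') (h : T' -> T) (g : T' -> C) l :
  cancel f h -> cancel h f -> hassum (g \o f) l -> hassum g l.
Proof.
move=> fK hK gl e /gl[s0 Hs0]; exists (map f s0) => s us ss.
have -> : \sum_(t <- s) g t = \sum_(t <- map h s) (g \o f) t.
  by rewrite big_map; apply: eq_bigr => t _ /=; rewrite hK.
apply: Hs0; first by rewrite map_inj_uniq //; exact: can_inj hK.
by move=> x xs; rewrite -[x]fK; apply/map_f/ss/map_f.
Qed.

Lemma hassum_sumtype T T' (g : T + T' -> C) l l' :
  hassum (g \o inl) l -> hassum (g \o inr) l' -> hassum g (l + l').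
Proof.
move=> gl gl' e e0; have e20 : 0 < e / 2 by rewrite divr_gt0.
have [s0 Hs0] := gl _ e20; have [s1 Hs1] := gl' _ e20.
pose L (x : T + T') := if x is inl t then Some t else None.
pose M (x : T + T') := if x is inr t then Some t else None.
exists (map inl s0 ++ map inr s1) => s us ss.
have -> : \sum_(x <- s) g x =
    \sum_(t <- pmap L s) g (inl t) + \sum_(t <- pmap M s) g (inr t).
  elim: s {us ss} => [|[t|t] s IH]; first by rewrite !big_nil addr0.
    by rewrite /= !big_cons IH addrA.
  by rewrite /= !big_cons IH addrCA.
rewrite opprD addrACA (splitr e); apply: le_lt_trans (ler_normD _ _) _.
apply: ltrD.
- apply: Hs0; first by apply: (@pmap_uniq _ _ _ inl) => // -[].
  move=> t ts; rewrite mem_pmap; apply/mapP; exists (inl t) => //.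
  by apply: ss; rewrite mem_cat map_f.
- apply: Hs1; first by apply: (@pmap_uniq _ _ _ inr) => // -[].
  move=> t ts; rewrite mem_pmap; apply/mapP; exists (inr t) => //.
  by apply: ss; rewrite mem_cat orbC map_f.
Qed.

(** A finite set [s] containing a large box [A x B] lies in a larger box [A' x B']. Sums over boxes
    factor, so the one over [A' x B'] is near [l * l']. What [s] misses is bounded by the difference
    of the absolute sums over the two boxes, both of which are near [L * L']. *)
Lemma hassum_prod T T' (g : T -> C) (g' : T' -> C) l l' L L' :
  hassum g l -> hassum g' l' ->
  hassum (fun t => `|g t|) L -> hassum (fun t => `|g' t|) L' ->
  hassum (fun t : T * T' => g t.1 * g' t.2) (l * l').
Proof.
move=> gl gl' gL gL' e e0.
pose M := `|l| + `|l'| + `|L| + `|L'| + 1.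
have M1 : 1 <= M by rewrite lerDr !addr_ge0.
have M0 : 0 < M by apply: lt_le_trans M1.
(* Three errors of size [d * (2 * M)] must fit below [e]: one from the large box, two from the
   absolute sums. The bound [d <= 1] controls the quadratic term in [near_prod]. *)
pose d := e / (8 * M + e).
have D0 : 0 < 8 * M + e by rewrite addr_gt0 // mulr_gt0.
have d0 : 0 < d by rewrite divr_gt0.
have d1 : d <= 1 by rewrite ler_pdivrMr // mul1r lerDr mulr_ge0 // ltW.
have dM : d * (8 * M) < e.
  rewrite /d mulrAC -mulrA gtr_pMr // ltr_pdivrMr // mul1r.
  by rewrite ltrDl.
have near_prod (x y x0 y0 : C) : `|x0| + `|y0| + 1 <= M ->
    `|x - x0| < d -> `|y - y0| < d -> `|x * y - x0 * y0| < d * (2 * M).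
  move=> hM hx hy.
  have -> : x * y - x0 * y0 = (x - x0) * (y - y0) + (x - x0) * y0 + x0 * (y - y0).
    ring.
  apply: le_lt_trans (ler_normD _ _) _.
  have h1 : `|(x - x0) * (y - y0) + (x - x0) * y0| <= d * (1 + `|y0|).
    apply: le_trans (ler_normD _ _) _; rewrite !normrM mulrDr mulr1.
    apply: lerD.
      rewrite -[leRHS]mulr1; apply: ler_pM => //; apply: ltW => //.
      exact: lt_le_trans d1.
    by apply: ler_wpM2r => //; apply: ltW.
  have h2 : `|x0 * (y - y0)| <= `|x0| * d.
    by rewrite normrM; apply: ler_wpM2l => //; apply: ltW.
  apply: le_lt_trans (lerD h1 h2) _; rewrite (mulrC `|x0|) -mulrDr ltr_pM2l //.
  have -> : 1 + `|y0| + `|x0| = `|x0| + `|y0| + 1 by ring.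
  by apply: (le_lt_trans hM); rewrite ltr_pMl // ltr1n.
have [s0 us0 Hs0] := hassum_uniq_witness gl d0.
have [s1 us1 Hs1] := hassum_uniq_witness gl' d0.
have [s2 us2 Hs2] := hassum_uniq_witness gL d0.
have [s3 us3 Hs3] := hassum_uniq_witness gL' d0.
pose A := undup (s0 ++ s2); pose B := undup (s1 ++ s3).
pose box (a : seq T) (b : seq T') := [seq (x, y) | x <- a, y <- b].
have ubox a b : uniq a -> uniq b -> uniq (box a b).
  by move=> ua ub; apply: allpairs_uniq => // -[x y] [x' y'].
exists (box A B) => s us ss.
pose A' := undup (A ++ map fst s); pose B' := undup (B ++ map snd s).
have AA' : {subset A <= A'} by move=> x xA; rewrite mem_undup mem_cat xA.
have BB' : {subset B <= B'} by move=> x xA; rewrite mem_undup mem_cat xA.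
have sbox : {subset s <= box A' B'}.
  move=> [x y] xs; apply/allpairsP; exists (x, y); split=> //=;
  by rewrite mem_undup mem_cat; apply/orP; right; apply/mapP; exists (x, y).
have [uA uB uA' uB'] : [/\ uniq A, uniq B, uniq A' & uniq B'].
  by split; exact: undup_uniq.
have sA : {subset s0 <= A} by move=> x xs; rewrite mem_undup mem_cat xs.
have sB : {subset s1 <= B} by move=> x xs; rewrite mem_undup mem_cat xs.
have sA2 : {subset s2 <= A} by move=> x xs; rewrite mem_undup mem_cat xs orbT.
have sB2 : {subset s3 <= B} by move=> x xs; rewrite mem_undup mem_cat xs orbT.
have sub_trans (S : eqType) (x y z : seq S) :
    {subset x <= y} -> {subset y <= z} -> {subset x <= z}.
  by move=> h k w /h/k.
have sum_box (a : seq T) (b : seq T') (F : T -> C) (F' : T' -> C) :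
    \sum_(t <- box a b) F t.1 * F' t.2 = (\sum_(x <- a) F x) * (\sum_(y <- b) F' y).
  rewrite big_allpairs mulr_suml; apply: eq_bigr => x _.
  by rewrite mulr_sumr.
have hl : `|l| + `|l'| + 1 <= M by rewrite /M lerD2r -!addrA lerD2l lerDl !addr_ge0.
have hL : `|L| + `|L'| + 1 <= M by rewrite /M lerD2r -[leRHS]addrA lerDr !addr_ge0.
set G := (fun t : T * T' => g t.1 * g' t.2).
have e1 := near_prod _ _ _ _ hl (Hs0 A' uA' (sub_trans _ _ _ _ sA AA'))
  (Hs1 B' uB' (sub_trans _ _ _ _ sB BB')).
have e2 := near_prod _ _ _ _ hL (Hs2 A' uA' (sub_trans _ _ _ _ sA2 AA'))
  (Hs3 B' uB' (sub_trans _ _ _ _ sB2 BB')).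
have e3 := near_prod _ _ _ _ hL (Hs2 A uA sA2) (Hs3 B uB sB2).
rewrite -!sum_box in e1 e2 e3.
(* Since [s] contains [box A B], the pairs of the large box outside [s] are among those outside
   [box A B]. *)
have e4 : `|\sum_(t <- box A' B') G t - \sum_(t <- s) G t|
    <= \sum_(t <- box A' B') `|g t.1| * `|g' t.2| -
       \sum_(t <- box A B) `|g t.1| * `|g' t.2|.
  rewrite (sum_subset G us (ubox _ _ uA' uB') sbox) addrAC subrr add0r.
  apply: le_trans (ler_norm_sum _ _ _) _.
  under eq_bigr do rewrite normrM.
  rewrite lerBrDr (@sum_subset _ _ _ s (box A' B')) ?ubox // addrC lerD2r.
  by apply: ler_sum_subset; rewrite ?ubox // => t; rewrite mulr_ge0.
have e5 : `|\sum_(t <- box A' B') G t - \sum_(t <- s) G t| < d * (2 * M) + d * (2 * M).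
  apply: le_lt_trans e4 _; set X := \sum_(_ <- _) _; set Y := \sum_(_ <- _) _.
  have -> : X - Y = `|X - Y|.
    rewrite ger0_norm // subr_ge0; apply: ler_sum_subset; [|exact: ubox..|].
      by move=> t; rewrite mulr_ge0.
    move=> [x y] /allpairsP[[x' y'] /= [hx hy [-> ->]]].
    by apply/allpairsP; exists (x', y'); split; rewrite /= ?AA' ?BB'.
  have -> : X - Y = (X - L * L') - (Y - L * L') by ring.
  apply: le_lt_trans (ler_normB _ _) _.
  exact: ltrD.
set X := \sum_(_ <- box A' B') _ in e1 e5.
have -> : \sum_(t <- s) G t - l * l' = (X - l * l') - (X - \sum_(t <- s) G t) by ring.
apply: le_lt_trans (ler_normB _ _) _.
apply: lt_trans (ltrD e1 e5) _; apply: le_lt_trans dM.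
have -> : d * (2 * M) + (d * (2 * M) + d * (2 * M)) = d * (6 * M) by ring.
by rewrite !ler_wpM2l ?ler_wpM2r ?ler_nat // ltW.
Qed.

End Hassum.
Local Open Scope classical_set_scope.

(** * Geometric bounds and completeness of the complex numbers *)

Definition geo_bounded (C : numFieldType) (g : nat -> C) :=
  exists K r : C, [/\ 0 <= K, 0 <= r, r < 1 & forall n, `|g n| <= K * r ^+ n].

(* The only form of completeness that is needed. R[i] has no complete normed
   module structure in the library, so the analysis is done over a numFieldType
   with this property. *)
Definition geo_complete (C : numFieldType) :=
  forall g : nat -> C, geo_bounded g -> cvgn (series g).

(** Real and imaginary parts are each dominated by the real geometric series; the bound for the
    imaginary part is obtained from the real part of [g n * 'i]. *)
Lemma complex_series_cvg (R : realType) (g : nat -> R[i]) (k t : R) :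
  0 <= t -> t < 1 -> (forall n, `|g n| <= (k * t ^+ n)%:C) ->
  exists l : R[i], forall e : R, 0 < e ->
    \forall n \near \oo, `|l - \sum_(0 <= j < n) g j| < e%:C.
Proof.
move=> t0 t1 gKr.
have cvg_part (f : nat -> R) : (forall n, `|f n|%:C <= `|g n|) ->
    cvgn (series (f : nat -> R^o)).
  move=> fg.
  have fk n : `|f n| <= k * t ^+ n by rewrite -lecR; apply: le_trans (fg n) (gKr n).
  apply: normed_cvg; apply: (@series_le_cvg _ _ (geometric k t)) => //.
  - by move=> n; exact: normr_ge0.
  - by move=> n /=; apply: le_trans (fk n).
  - by apply: is_cvg_geometric_series; rewrite ger0_norm.
have normi : `|'i| = 1 :> R[i].
  by rewrite normc_def /= expr0n add0r expr1n sqrtr1.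
have cRe : cvgn (series (fun n => complex.Re (g n) : R^o)).
  by apply: cvg_part => n; exact: normc_ge_Re.
have cIm : cvgn (series (fun n => complex.Im (g n) : R^o)).
  apply: cvg_part => n; have := normc_ge_Re (g n * 'i).
  by rewrite ReiNIm normrN normrM normi mulr1.
exists ((limn (series (fun n => complex.Re (g n) : R^o)))%:C
  + 'i * (limn (series (fun n => complex.Im (g n) : R^o)))%:C) => e e0.
have d0 : 0 < e / 2 by rewrite divr_gt0.
have /cvgrPdist_lt/(_ _ d0) nRe := cRe; have /cvgrPdist_lt/(_ _ d0) nIm := cIm.
near=> n.
have h1 : `|limn (series (fun n => complex.Re (g n) : R^o)) -
    series (fun n => complex.Re (g n) : R^o) n| < e / 2 by near: n; exact: nRe.
have h2 : `|limn (series (fun n => complex.Im (g n) : R^o)) -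
    series (fun n => complex.Im (g n) : R^o) n| < e / 2 by near: n; exact: nIm.
have -> : \sum_(0 <= j < n) g j =
    (series (fun n => complex.Re (g n) : R^o) n)%:C
    + 'i * (series (fun n => complex.Im (g n) : R^o) n)%:C.
  rewrite /series /= !rmorph_sum mulr_sumr -big_split /=.
  by apply: eq_bigr => j _; rewrite -complexE.
rewrite opprD addrACA -mulrBr -!rmorphB; apply: le_lt_trans (ler_normD _ _) _.
rewrite normrM normi mul1r.
have normR (x : R) : `|x%:C| = `|x|%:C.
  by rewrite normc_def /= expr0n addr0 sqrtr_sqr.
by rewrite !normR -rmorphD ltcR [ltRHS]splitr; apply: ltrD.
Unshelve. all: by end_near.
Qed.

(** Nonnegative elements of [R[i]] are real, so the constants [K], [r] and the tolerance [e] all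
    come from [R]. *)
Lemma complex_geo_complete (R : realType) : geo_complete R[i].
Proof.
move=> g [K [r [K0 r0 r1 gKr]]].
have /complex_realP[k Kk] := ger0_real K0.
have /complex_realP[t rt] := ger0_real r0.
have t0 : 0 <= t by rewrite -ler0c -rt.
have t1 : t < 1 by rewrite -ltcR -rt.
have [n|l Hl] := @complex_series_cvg R g k t t0 t1.
  by rewrite rmorphM rmorphXn; have := gKr n; rewrite Kk rt.
apply/cvg_ex; exists l; apply/cvgrPdist_lt => e e0.
have /complex_realP[d ed] := gtr0_real e0.
by rewrite ed; apply: Hl; rewrite -ltcR -ed.
Qed.

(** * Series and infinite products with geometrically bounded terms *)

Section Geometric.
Context {C : numFieldType}.
Hypothesis cC : geo_complete C.
Implicit Types g u : nat -> C.

Lemma geo_bounded_norm g : geo_bounded g -> geo_bounded (fun n => `|g n|).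
Proof.
move=> [K [r [K0 r0 r1 gKr]]]; exists K, r; split=> // n.
by rewrite normr_id.
Qed.

Lemma geo_bounded_cvg0 g : geo_bounded g -> g @ \oo --> 0.
Proof. by move=> /cC; exact: cvg_series_cvg_0. Qed.

Lemma cvg_expr0 (x : C) : `|x| < 1 -> (fun n => x ^+ n) @ \oo --> 0.
Proof.
move=> x1; apply: geo_bounded_cvg0; exists 1, `|x|; split=> // n.
by rewrite normrX mul1r.
Qed.

(** An interval of exponents starting at [n0] covers [s], and its geometric sum telescopes after
    multiplication by [1 - r]. *)
Lemma tail_le (r : C) n0 (s : seq nat) : 0 <= r -> r < 1 -> uniq s ->
  (forall n, n \in s -> (n0 <= n)%N) -> \sum_(n <- s) r ^+ n <= r ^+ n0 / (1 - r).
Proof.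
move=> r0 r1 us hs.
have r1' : 0 < 1 - r by rewrite subr_gt0.
pose m := (\max_(n <- s) n).+1.
apply: (@le_trans _ _ (\sum_(n <- index_iota n0 (n0 + m)) r ^+ n)).
  apply: ler_sum_subset; rewrite ?iota_uniq //.
    by move=> n; rewrite exprn_ge0.
  move=> n ns; rewrite mem_index_iota hs //= /m addnS ltnS.
  by apply: leq_trans (leq_addl _ _); exact: (@leq_bigmax_seq _ _ xpredT id).
rewrite ler_pdivlMr // mulr_suml.
have -> : \sum_(n0 <= i < n0 + m) r ^+ i * (1 - r) = r ^+ n0 - r ^+ (n0 + m).
  elim: m => [|m IH]; first by rewrite addn0 big_geq // subrr.
  by rewrite addnS big_nat_recr ?leq_addr //= IH exprS; ring.
by rewrite lerBlDr lerDl exprn_ge0.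
Qed.

Lemma hassum_series g : geo_bounded g -> hassum g (limn (series g)).
Proof.
move=> gb; have [K [r [K0 r0 r1 gKr]]] := gb.
have r1' : 0 < 1 - r by rewrite subr_gt0.
move=> e e0; have e20 : 0 < e / 2 by rewrite divr_gt0.
have /cvgrPdist_lt/(_ _ e20) sg := cC gb.
have rn : (fun n => K * r ^+ n / (1 - r)) @ \oo --> (K * 0 / (1 - r) : C).
  apply: cvgM; last exact: cvg_cst.
  by apply: cvgM; [exact: cvg_cst | apply: cvg_expr0; rewrite ger0_norm].
have /cvgrPdist_lt/(_ _ e20) {}rn := rn.
have [n0 [h1 h2]] : exists n0, `|limn (series g) - series g n0| < e / 2 /\
    `|K * 0 / (1 - r) - K * r ^+ n0 / (1 - r)| < e / 2.
  near \oo => n; exists n; split; near: n; [exact: sg | exact: rn].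
exists (iota 0 n0) => s us ss.
rewrite (sum_subset g (iota_uniq _ _) us ss) (splitr e).
have -> : \sum_(t <- iota 0 n0) g t = series g n0.
  by rewrite /series /= /index_iota subn0.
rewrite addrAC; apply: le_lt_trans (ler_normD _ _) _; apply: ltrD.
  by rewrite distrC.
apply: le_lt_trans h2; rewrite mulr0 mul0r sub0r normrN [leRHS]ger0_norm; last first.
  by rewrite divr_ge0 ?mulr_ge0 ?exprn_ge0 // ltW.
apply: le_trans (ler_norm_sum _ _ _) _.
apply: (@le_trans _ _ (\sum_(i <- s | i \notin iota 0 n0) K * r ^+ i)).
  by apply: ler_sum.
rewrite -mulr_sumr -mulrA; apply: ler_wpM2l => //.
rewrite -big_filter; apply: tail_le; rewrite ?filter_uniq // => n.
by rewrite mem_filter mem_iota /= add0n -leqNgt => /andP[].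
Unshelve. all: by end_near.
Qed.

(** Ratio test, with [r] halfway between the norm of the limit and 1. *)
Lemma geo_bounded_ratio g (c : nat -> C) l : c @ \oo --> l -> `|l| < 1 ->
  (forall n, g n.+1 = c n * g n) -> geo_bounded g.
Proof.
move=> cl l1 gc; pose r := (1 + `|l|) / 2.
have r1 : r < 1 by rewrite /r ltr_pdivrMr // mul1r -[2]/(1 + 1) ltrD2l.
have r0 : 0 < r by rewrite /r divr_gt0 // ltr_wpDr.
have lr : 0 < r - `|l|.
  rewrite (_ : _ - _ = (1 - `|l|) / 2); last by rewrite /r; field.
  by rewrite divr_gt0 // subr_gt0.
have /cvgrPdist_lt/(_ _ lr)[N _ HN] := cl.
have cr n : (N <= n)%N -> `|c n| <= r.
  move=> Nn; have /= := HN n Nn; rewrite distrC => h.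
  have := le_lt_trans (lerB_dist _ _) h.
  by rewrite ltrD2r => /ltW.
(* Each of the first [N.+1] quotients is at most this sum, so the bound holds up to [N]; from there
   on the ratio bound [cr] carries it by induction. *)
pose K := \sum_(0 <= k < N.+1) `|g k| / r ^+ k.
have K0 : 0 <= K.
  by apply: sumr_ge0 => k _; rewrite divr_ge0 ?exprn_ge0 // ltW.
exists K, r; split=> //; first exact: ltW.
have small n : (n <= N)%N -> `|g n| <= K * r ^+ n.
  move=> nN; rewrite -ler_pdivrMr ?exprn_gt0 // /K.
  rewrite (bigD1_seq n) ?mem_index_iota ?iota_uniq //= lerDl.
  by apply: sumr_ge0 => k _; rewrite divr_ge0 ?exprn_ge0 // ltW.
elim=> [|n IH]; first exact: small.
have [/small//|Nn] := leqP n.+1 N.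
rewrite gc normrM exprS mulrCA; apply: ler_pM => //.
exact: cr.
Qed.

(** The partial products satisfy [P N = 1 + \sum_(n < N) P n * u n], which turns the product into a
    series. By the ratio test [P n * r ^+ n] decays geometrically, because its ratio [(1 + u n) * r]
    tends to [r]; hence so does [P n * u n]. *)
Lemma cvg_prod_geo_bounded u : geo_bounded u ->
  cvgn (fun N : nat => \prod_(0 <= n < N) (1 + u n)).
Proof.
move=> ub; have [K [r [K0 r0 r1 uKr]]] := ub.
pose P := (fun N : nat => \prod_(0 <= n < N) (1 + u n)).
have Pr : geo_bounded (fun n => P n * r ^+ n).
  apply: (@geo_bounded_ratio _ (fun n => (1 + u n) * r) ((1 + 0) * r)).
  - apply: cvgM; last exact: cvg_cst.
    by apply: cvgD; [exact: cvg_cst | exact: geo_bounded_cvg0].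
  - by rewrite addr0 mul1r ger0_norm.
  - by move=> n; rewrite /P big_nat_recr //= exprS; ring.
have Pu : geo_bounded (fun n => P n * u n).
  have [K' [r' [K'0 r'0 r'1 H]]] := Pr; exists (K * K'), r'; split=> // [|n].
    exact: mulr_ge0.
  rewrite normrM; apply: (@le_trans _ _ (K * `|P n * r ^+ n|)).
    rewrite normrM mulrCA (ger0_norm (exprn_ge0 _ r0)).
    by apply: ler_wpM2l.
  by rewrite -mulrA; apply: ler_wpM2l.
have -> : (fun N : nat => \prod_(0 <= n < N) (1 + u n)) =
    (fun N => 1 + series (fun n => P n * u n) N).
  apply/funext; elim=> [|N IH].
    by rewrite big_geq // /series /= big_geq ?addr0.
  rewrite big_nat_recr //= /series /= big_nat_recr //= addrA.
  by rewrite [in LHS]IH mulrDr mulr1 -[in X in _ + X](IH); congr (_ + _).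
by apply: is_cvgD; [exact: is_cvg_cst | exact: cC].
Qed.

End Geometric.

(** * Terms of the theta series and finite q-products *)

Lemma theta_termS (C : numFieldType) (a b : C) (j : int) : a != 0 -> b != 0 ->
  theta_term a b (j + 1) = a * (a * b) ^ j * theta_term a b j.
Proof.
move=> a0 b0; rewrite /theta_term.
have -> : ((j + 1) * (j + 1 + 1))%R = (j + 1) * 2 + j * (j + 1) by ring.
have -> : ((j + 1) * (j + 1 - 1))%R = j * 2 + j * (j - 1) by ring.
rewrite !divzMDl // !expfzDr // expr1z expfzMl; ring.
Qed.

Lemma theta_term0 (C : numFieldType) (a b : C) : theta_term a b 0 = 1.
Proof. by rewrite /theta_term !mul0r div0z !expr0z mulr1. Qed.

Lemma theta_termN (C : numFieldType) (a b : C) (j : int) :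
  theta_term a b (- j) = theta_term b a j.
Proof.
rewrite /theta_term mulrC.
by congr (_ ^ (_ %/ _)%Z * _ ^ (_ %/ _)%Z); ring.
Qed.

(* The Gaussian binomial coefficient when F n = (q; q)_n. *)
Definition gaussbin (C : numFieldType) (F : nat -> C) (n k : nat) : C :=
  if (k <= n)%N then F n / (F k * F (n - k)%N) else 0.

Definition qpoch_part (C : numFieldType) (l q : C) (N : nat) : C :=
  \prod_(0 <= n < N) (1 - l * q ^+ n).

(** * The Jacobi triple product *)

Section JacobiTripleProduct.
Context {C : numFieldType}.
Hypothesis cC : geo_complete C.

Lemma hassum_int (g : int -> C) :
  geo_bounded (fun n : nat => g n%:Z) ->
  geo_bounded (fun n : nat => g (- n.+1%:Z)) ->
  hassum g (limn (series (fun n : nat => g n%:Z)) +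
            limn (series (fun n : nat => g (- n.+1%:Z)))).
Proof.
move=> gp gn.
apply: (@hassum_bij _ _ _
  (fun x : nat + nat => match x with inl n => n%:Z | inr n => - n.+1%:Z end)
  (fun x : int => match x with Posz n => inl n | Negz n => inr n end)).
- by case.
- by case=> n //=; rewrite NegzE.
- by apply: hassum_sumtype; exact: hassum_series.
Qed.

(** Consecutive terms have ratio [a * (a * b) ^+ n], which tends to 0. *)
Lemma theta_term_geo_bounded (a b : C) : a != 0 -> b != 0 -> `|a * b| < 1 ->
  geo_bounded (fun n : nat => theta_term a b n%:Z).
Proof.
move=> a0 b0 ab1.
apply: (@geo_bounded_ratio _ _ (fun n : nat => a * (a * b) ^+ n) (a * 0)).
- by apply: cvgM; [exact: cvg_cst | exact: cvg_expr0].
- by rewrite mulr0 normr0.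
- by move=> n; rewrite -addn1 PoszD theta_termS.
Qed.

Lemma geo_bounded_shift (g : nat -> C) :
  geo_bounded g -> geo_bounded (fun n => g n.+1).
Proof.
move=> [K [r [K0 r0 r1 gKr]]]; exists (K * r), r; split=> //.
  exact: mulr_ge0.
by move=> n; rewrite -mulrA -exprS.
Qed.

(** The negative half is the positive half for [(b, a)], shifted by one. The absolute sum [L] is
    what [hassum_prod] and [tannery] ask for. *)
Lemma hassum_theta (a b : C) : a != 0 -> b != 0 -> `|a * b| < 1 ->
  hassum (theta_term a b) (theta a b) /\
  exists L, hassum (fun n => `|theta_term a b n|) L.
Proof.
move=> a0 b0 ab1; have hp := theta_term_geo_bounded a0 b0 ab1.
have hn : geo_bounded (fun n : nat => theta_term a b (- n.+1%:Z)).
  under eq_fun do rewrite theta_termN.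
  apply: (@geo_bounded_shift (fun n : nat => theta_term b a n%:Z)).
  by apply: theta_term_geo_bounded; rewrite // mulrC.
split; first exact: hassum_int.
by eexists; apply: hassum_int; exact: geo_bounded_norm.
Qed.

Lemma near_subset (T : eqType) (s : nat -> seq T) (s0 : seq T) :
  (forall t, \forall N \near \oo, t \in s N) ->
  \forall N \near \oo, {subset s0 <= s N}.
Proof.
move=> hs; elim: s0 => [|x s0 IH]; first by near=> N.
near=> N => y; rewrite inE => /orP[/eqP ->|].
  by near: N; exact: hs.
by move: y; near: N.
Unshelve. all: by end_near.
Qed.

(** Dominated convergence: on a fixed finite set [S] carrying almost all of the absolute sum the
    weights tend to 1, and outside [S] the weighted sum is at most [B] times a small tail. *)
Lemma tannery (T : eqType) (g : T -> C) l L (w : nat -> T -> C)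
    (s : nat -> seq T) B :
  hassum g l -> hassum (fun t => `|g t|) L -> 0 <= B ->
  (forall N t, `|w N t| <= B) -> (forall t, w ^~ t @ \oo --> (1 : C)) ->
  (forall N, uniq (s N)) -> (forall t, \forall N \near \oo, t \in s N) ->
  (fun N => \sum_(t <- s N) w N t * g t) @ \oo --> l.
Proof.
move=> gl gL B0 wB w1 us hs; apply/cvgrPdist_lt => e e0.
have D0 : 0 < B * 2 + 3 by rewrite ltr_wpDl // mulr_ge0.
(* The errors are [d] for the weights on [S], [d] for the sum over [S] against [l], and
   [B * (d * 2)] for the tail. *)
pose d := e / (B * 2 + 3).
have d0 : 0 < d by rewrite divr_gt0.
have [s1 Hs1] := gl _ d0; have [s2 Hs2] := gL _ d0.
pose S := undup (s1 ++ s2).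
have uS : uniq S := undup_uniq _.
have s1S : {subset s1 <= S} by move=> x xs; rewrite mem_undup mem_cat xs.
have s2S : {subset s2 <= S} by move=> x xs; rewrite mem_undup mem_cat xs orbT.
have wS : (fun N => \sum_(t <- S) w N t * g t) @ \oo --> \sum_(t <- S) 1 * g t.
  apply: cvg_big; first exact: add_continuous.
  by move=> t _; apply: cvgM; [exact: w1 | exact: cvg_cst].
have {wS} /cvgrPdist_lt/(_ _ d0) wS := wS.
near=> N.
have SN : {subset S <= s N} by near: N; exact: near_subset.
have h1 : `|\sum_(t <- S) 1 * g t - \sum_(t <- S) w N t * g t| < d.
  by near: N; exact: wS.
have h2 := Hs1 _ uS s1S.
have tail : \sum_(t <- s N | t \notin S) `|g t| <= d * 2.
  have -> : \sum_(t <- s N | t \notin S) `|g t| =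
      (\sum_(t <- s N) `|g t| - L) - (\sum_(t <- S) `|g t| - L).
    by rewrite (sum_subset _ uS (us N) SN); ring.
  rewrite -[leLHS]ger0_norm; last first.
    rewrite opprB addrA subrK subr_ge0.
    exact: ler_sum_subset.
  rewrite mulr_natr mulr2n; apply: le_trans (ler_normB _ _) _.
  apply: lerD; apply: ltW; apply: Hs2 => //.
  by move=> x /s2S /SN.
have h3 : `|\sum_(t <- s N | t \notin S) w N t * g t| <= B * (d * 2).
  apply: le_trans (ler_norm_sum _ _ _) _.
  apply: le_trans (ler_wpM2l B0 tail); rewrite mulr_sumr; apply: ler_sum => t _.
  by rewrite normrM ler_wpM2r.
rewrite (sum_subset _ uS (us N) SN).
have -> : l - (\sum_(t <- S) w N t * g t + \sum_(t <- s N | t \notin S) w N t * g t)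
  = (\sum_(t <- S) 1 * g t - \sum_(t <- S) w N t * g t)
    - (\sum_(t <- S) g t - l) - \sum_(t <- s N | t \notin S) w N t * g t.
  by under [\sum_(_ <- _) 1 * _]eq_bigr do rewrite mul1r; ring.
apply: le_lt_trans (ler_normB _ _) _.
apply: le_lt_trans (lerD (ler_normB _ _) h3) _.
apply: (@lt_le_trans _ _ (d + d + B * (d * 2))).
  by rewrite ltrD2r ltrD.
have -> : d + d + B * (d * 2) = d * (B * 2 + 2) by ring.
rewrite /d mulrAC ler_pdivrMr // ler_pM2l // lerD2l.
by rewrite ler_nat.
Unshelve. all: by end_near.
Qed.

Lemma cvg_qpoch (l q : C) : `|q| < 1 -> qpoch_part l q @ \oo --> qpoch l q.
Proof.
move=> q1; apply: (cvg_prod_geo_bounded cC (u := fun n => - (l * q ^+ n))).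
exists `|l|, `|q|; split=> // n; by rewrite normrN normrM normrX.
Qed.

Lemma cvg_bound (f : nat -> C) (l : C) : f @ \oo --> l ->
  exists2 B : C, 0 <= B & forall n, `|f n| <= B.
Proof.
move=> fl; have /cvg_seq_bounded[M [Mr HM]] : cvgn f by apply/cvg_ex; exists l.
exists (`|M| + 1); first exact: addr_ge0.
by move=> n; apply: HM => //; rewrite ltr_pwDr ?real_ler_norm.
Qed.

Lemma qpoch_part_neq0 (q : C) n : `|q| < 1 -> qpoch_part q q n != 0.
Proof.
move=> q1; rewrite prodf_seq_neq0; apply/allP => i _ /=.
rewrite -exprS subr_eq0 eq_sym; apply/eqP => qi.
have : `|q ^+ i.+1| < 1 by rewrite normrX exprn_ilt1.
by rewrite qi normr1 ltxx.
Qed.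

Lemma qpoch_part_bounds (q : C) : `|q| < 1 -> qpoch q q != 0 /\ exists2 B : C, 0 <= B &
  forall n, `|qpoch_part q q n| <= B /\ `|(qpoch_part q q n)^-1| <= B.
Proof.
move=> q1; have q1' : 0 < 1 - `|q| by rewrite subr_gt0.
(* Chosen so that [1 + u n] is the inverse of the factor [1 - q ^+ n.+1]. *)
pose u n := q ^+ n.+1 / (1 - q ^+ n.+1).
have den n : 1 - `|q| <= `|1 - q ^+ n.+1|.
  have := lerB_dist (1 : C) (q ^+ n.+1); rewrite normr1; apply: le_trans.
  by rewrite lerD2l lerN2 normrX exprS ler_piMr // exprn_ile1 // ltW.
have den0 n : 1 - q ^+ n.+1 != 0.
  by rewrite -normr_gt0; apply: lt_le_trans (den n).
have ub : geo_bounded u.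
  exists (`|q| / (1 - `|q|)), `|q|; split=> //.
    by rewrite divr_ge0 // ltW.
  move=> n; rewrite /u normrM normfV mulrAC -exprS -normrX.
  apply: ler_wpM2l => //; rewrite lef_pV2 // posrE //.
  by apply: lt_le_trans (den n).
have uE N : \prod_(0 <= n < N) (1 + u n) = (qpoch_part q q N)^-1.
  rewrite /qpoch_part -prodfV; apply: eq_bigr => n _.
  by rewrite /u -exprS; field.
(* The inverses converge too, hence the limit is nonzero. *)
have cu := cvg_prod_geo_bounded cC ub.
have cP := @cvg_qpoch q q q1.
have [B1 B10 HB1] := cvg_bound cP.
have [B2 B20 HB2] := cvg_bound cu.
split; last first.
  exists (B1 + B2); first exact: addr_ge0.
  move=> n; split; first by apply: le_trans (HB1 n) _; rewrite lerDl.
  by rewrite -uE; apply: le_trans (HB2 n) _; rewrite lerDr.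
have h : limn (fun N : nat => \prod_(0 <= n < N) (1 + u n)) * qpoch q q = 1.
  apply: (cvg_unique (@norm_hausdorff _ C) (cvgM cu cP)).
  rewrite (_ : _ \* _ = cst 1); first exact: cvg_cst.
  by apply/funext => n /=; rewrite uE mulVf // qpoch_part_neq0.
apply/eqP => q0; rewrite q0 mulr0 in h.
by have := oner_neq0 C; rewrite -h eqxx.
Qed.

Lemma qpoch_partS (l q : C) n :
  qpoch_part l q n.+1 = qpoch_part l q n * (1 - l * q ^+ n).
Proof. by rewrite /qpoch_part big_nat_recr. Qed.

Section Finite.
Variables (a b : C).
Hypotheses (a0 : a != 0) (b0 : b != 0) (ab1 : `|a * b| < 1).
Local Notation q := (a * b).
Local Notation F := (qpoch_part q q).
Local Notation T := (theta_term (- a) (- b)).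
Local Notation gb := (gaussbin F).

Lemma gaussbin_small n k : (n < k)%N -> gb n k = 0.
Proof. by rewrite /gaussbin ltnNge => /negbTE ->. Qed.

Lemma gaussbin0 n : gb n 0 = 1.
Proof.
by rewrite /gaussbin /= subn0 {2}/qpoch_part big_geq // mul1r divff // qpoch_part_neq0.
Qed.

(** The two q-Pascal rules: [finite_jacobi] uses the first to increase [M] and the second to
    increase [N]. *)
Lemma gaussbin_pascal n k : (k <= n)%N ->
  gb n.+1 k.+1 = gb n k.+1 + q ^+ (n - k) * gb n k /\
  gb n.+1 k.+1 = gb n k + q ^+ k.+1 * gb n k.+1.
Proof.
have F0 m : F m != 0 by exact: qpoch_part_neq0.
have dq m : 1 - q * q ^+ m != 0.
  by have := F0 m.+1; rewrite qpoch_partS mulf_eq0 negb_or => /andP[].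
(* For [k = n] the coefficient [gb n k.+1] is 0 by convention rather than a quotient of products, so
   this case is separate. *)
rewrite leq_eqVlt => /predU1P[<-|kn].
  rewrite (@gaussbin_small k k.+1) // subnn expr0 mul1r add0r mulr0 addr0.
  have F00 : F 0%N = 1 by rewrite /qpoch_part big_geq.
  by rewrite /gaussbin !leqnn !subnn F00 !mulr1 !divff.
have [d ->] : exists d, n = (k + d).+1.
  by exists (n - k.+1)%N; rewrite -addSn subnKC.
rewrite /gaussbin !ltnS !leq_addr (leq_trans (leq_addr d k) (leqnSn _)).
have [-> -> ->] : [/\ (k + d).+2 - k.+1 = d.+1, (k + d).+1 - k.+1 = d
  & (k + d).+1 - k = d.+1]%N by split; lia.
rewrite !qpoch_partS !exprS !exprD.
by split; field; rewrite !F0 !dq.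
Qed.

(** Induction on [M] for [N = 0], then on [N]. Each new factor [1 - a * q ^+ M] or [1 - b * q ^+ N]
    splits the sum in two; after an index shift, using the recurrence [TS], a Pascal rule recombines
    the halves. *)
Lemma finite_jacobi M N : qpoch_part a q M * qpoch_part b q N =
  \sum_(0 <= k < (M + N).+1) gb (M + N) k * T (k%:Z - N%:Z).
Proof.
have q0 : q != 0 by rewrite mulf_neq0.
have TS j : T (j + 1) = - a * q ^ j * T j.
  by rewrite theta_termS ?oppr_eq0 // mulrNN.
elim: N => [|N IH].
  rewrite {2}/qpoch_part big_geq // mulr1 addn0.
  elim: M => [|M IH].
    rewrite /qpoch_part big_geq // big_nat1 gaussbin0 subrr.
    by rewrite theta_term0 mulr1.
  rewrite qpoch_partS IH mulrBr mulr1 [in RHS]big_nat_recl // gaussbin0 mul1r.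
  have -> : \sum_(0 <= k < M.+1) gb M.+1 k.+1 * T (k.+1%:Z - 0%:Z) =
      \sum_(0 <= k < M.+1) gb M k.+1 * T (k.+1%:Z - 0%:Z)
      + \sum_(0 <= k < M.+1) - (a * q ^+ M) * (gb M k * T (k%:Z - 0%:Z)).
    rewrite -big_split /=; apply: eq_big_nat => k /andP[_]; rewrite ltnS => kM.
    rewrite (gaussbin_pascal kM).1 mulrDl !subr0 -addn1 PoszD TS.
    have -> : q ^+ M = q ^+ (M - k) * q ^+ k by rewrite -exprD subnK.
    rewrite -exprnP; ring.
  rewrite -mulr_sumr addrA; congr (_ + _); last by rewrite mulNr mulrC.
  rewrite big_nat_recl // gaussbin0 mul1r; congr (_ + _).
  by rewrite big_nat_recr //= gaussbin_small // mul0r addr0.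
rewrite qpoch_partS mulrA IH mulrBr mulr1 addnS [in RHS]big_nat_recl // gaussbin0 mul1r.
have -> : \sum_(0 <= k < (M + N).+1) gb (M + N).+1 k.+1 * T (k.+1%:Z - N.+1%:Z) =
    \sum_(0 <= k < (M + N).+1) gb (M + N) k * T (k%:Z - N%:Z)
    + \sum_(0 <= k < (M + N).+1) q ^+ k.+1 * gb (M + N) k.+1 * T (k.+1%:Z - N.+1%:Z).
  rewrite -big_split /=; apply: eq_big_nat => k /andP[_]; rewrite ltnS => kM.
  rewrite (gaussbin_pascal kM).2 mulrDl; congr (_ * T _ + _).
  lia.
rewrite addrCA; congr (_ + _).
(* The isolated first term is the missing summand of index 0, so the second sum can start at 0. *)
have -> : T (0%:Z - N.+1%:Z) = q ^+ 0 * gb (M + N) 0 * T (0%:Z - N.+1%:Z).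
  by rewrite expr0 gaussbin0 !mul1r.
rewrite -(big_nat_recl _ _ (fun k => q ^+ k * gb (M + N) k * T (k%:Z - N.+1%:Z))) //.
rewrite [in RHS]big_nat_recr //= (@gaussbin_small _ (M + N).+1) // mulr0 mul0r addr0.
(* Termwise, by [TS], multiplication by [- (b * q ^+ N)] turns [T (k - N)] into
   [q ^+ k * T (k - N - 1)]. *)
rewrite mulrC -mulNr mulr_sumr; apply: eq_big_nat => k _.
have -> : k%:Z - N%:Z = (k%:Z - N.+1%:Z) + 1 by lia.
rewrite TS expfzDr // -!exprnP.
have -> : q ^ (- N.+1%:Z) = (q ^+ N)^-1 * q^-1 by rewrite -exprnN exprSr invfM.
by field; rewrite a0 b0 expf_neq0.
Qed.

End Finite.

Lemma cvg_reindex (f : nat -> C) (l : C) (k : nat -> nat) :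
  f @ \oo --> l -> (forall n, \forall N \near \oo, (n <= k N)%N) ->
  (fun N => f (k N)) @ \oo --> l.
Proof.
move=> fl kn; apply: (cvg_comp k f _ fl) => A [n _ nA].
by apply: filterS (kn n) => N /nA.
Qed.

(** The case [M = N] of [finite_jacobi], multiplied by [F N], is a weighted partial sum of the theta
    series; [tannery] gives its limit. *)
Lemma jacobi_triple_product (a b : C) : a != 0 -> b != 0 -> `|a * b| < 1 ->
  theta (- a) (- b) =
  qpoch a (a * b) * qpoch b (a * b) * qpoch (a * b) (a * b).
Proof.
move=> a0 b0 ab1; set q := a * b; pose F := qpoch_part q q.
have [L0 [B B0 FB]] := @qpoch_part_bounds q ab1.
have cF : F @ \oo --> qpoch q q := @cvg_qpoch q q ab1.
have [hT [L hL]] : hassum (theta_term (- a) (- b)) (theta (- a) (- b)) /\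
    exists L, hassum (fun n => `|theta_term (- a) (- b) n|) L.
  by apply: hassum_theta; rewrite ?oppr_eq0 // mulrNN.
(* For [j] in [s N] the integer [N + j] lies between 0 and [2 * N], so [absz] changes nothing there;
   for the remaining [j] only boundedness of the weight matters. *)
pose w (N : nat) (j : int) := F N * gaussbin F (N + N) (absz (N%:Z + j)%R).
pose s (N : nat) := [seq k%:Z - N%:Z | k <- iota 0 (N + N).+1].
have H : (fun N => \sum_(j <- s N) w N j * theta_term (- a) (- b) j) @ \oo
    --> theta (- a) (- b).
  apply: (tannery (B := B * (B * (B * B))) hT hL).
  - by rewrite !mulr_ge0.
  - move=> N j; rewrite /w normrM; apply: ler_pM => //; first exact: (FB N).1.
    rewrite /gaussbin; case: ifP => _; last by rewrite normr0 !mulr_ge0.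
    rewrite normrM; apply: ler_pM => //; first exact: (FB _).1.
    by rewrite invfM normrM; apply: ler_pM => //; exact: (FB _).2.
  - move=> j.
    (* All four factors [F] in the weight tend to the same nonzero limit, and they cancel. *)
    have -> : (1 : C) = qpoch q q * (qpoch q q * (qpoch q q * qpoch q q)^-1).
      by field.
    pose f (N : nat) := F N * (F (N + N)%N *
      (F (absz (N%:Z + j)%R) * F (N + N - absz (N%:Z + j)%R)%N)^-1).
    have fw : {near \oo, f =1 w^~ j}.
      near=> N; rewrite /w /gaussbin ifT //.
      by have : (absz j <= N)%N by [near: N; exact: nbhs_infty_ge]; lia.
    apply: cvg_trans (near_eq_cvg fw) _.
    apply: cvgM => //; apply: cvgM.
      apply: cvg_reindex => // n; near=> N.
      by have : (n <= N)%N by [near: N; exact: nbhs_infty_ge]; lia.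
    apply: cvgV; first by rewrite mulf_neq0.
    apply: cvgM; apply: cvg_reindex => // n; near=> N;
      have : (n + absz j <= N)%N by [near: N; exact: nbhs_infty_ge]; lia.
  - by move=> N; rewrite map_inj_uniq ?iota_uniq // => x y; lia.
  - move=> j; near=> N; apply/mapP; exists (absz (N%:Z + j)%R).
      rewrite mem_iota; have : (absz j <= N)%N by near: N; exact: nbhs_infty_ge.
      by lia.
    by have : (absz j <= N)%N by [near: N; exact: nbhs_infty_ge]; lia.
have cP : (fun N => qpoch_part a q N * qpoch_part b q N * F N) @ \oo -->
    qpoch a q * qpoch b q * qpoch q q.
  by apply: cvgM => //; apply: cvgM; exact: cvg_qpoch.
apply: (cvg_unique (@norm_hausdorff _ C) H).
rewrite (_ : (fun N => _) = fun N => qpoch_part a q N * qpoch_part b q N * F N) //.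
apply/funext => N; rewrite finite_jacobi // mulr_suml /s big_map /index_iota subn0.
apply: eq_bigr => k _; rewrite /w addrC subrK absz_nat; ring.
Unshelve. all: by end_near.
Qed.

End JacobiTripleProduct.

(* exprz_exp with the numFieldType instance fixed: rewriting with the original
   fails to unify the ring structures. *)
Lemma expfz_exp (F : numFieldType) (x : F) (m n : int) : (x ^ m) ^ n = x ^ (m * n).
Proof. exact: exprz_exp. Qed.

(** * Signed monomials and reindexings of pairs of integers *)

Definition signed_monomial (C : numFieldType) (p z : C) (e x y : int) : C :=
  (-1) ^ e * p ^ x * z ^ y.

Section QuotientIdentities.
Context {C : numFieldType}.
Hypothesis cC : geo_complete C.
Variables p z : C.
Hypotheses (p0 : p != 0) (z0 : z != 0) (p1 : `|p| < 1).
Local Notation mono := (signed_monomial p z).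

Lemma monoM e x y e' x' y' :
  mono e x y * mono e' x' y' = mono (e + e') (x + x') (y + y').
Proof.
rewrite /signed_monomial !expfzDr ?oppr_eq0 ?oner_eq0 //; ring.
Qed.

Lemma monoX e x y n : mono e x y ^ n = mono (e * n) (x * n) (y * n).
Proof. by rewrite /signed_monomial !expfzMl !expfz_exp. Qed.

Lemma mono_neq0 e x y : mono e x y != 0.
Proof. by rewrite !mulf_neq0 ?expfz_neq0 // oppr_eq0 oner_eq0. Qed.

(** The sign depends only on the parity of its exponent. With [d] supplied by the caller, comparing
    terms becomes polynomial identities between exponents. *)
Lemma eq_mono d e x y e' x' y' : e = e' + d * 2 -> x = x' -> y = y' ->
  mono e x y = mono e' x' y'.
Proof.
move=> -> -> ->; rewrite /signed_monomial expfzDr ?oppr_eq0 ?oner_eq0 //.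
rewrite [d * 2]mulrC -expfz_exp -[(-1) ^ 2]/((-1) ^+ 2).
by rewrite sqrrN expr1n exp1rz mulr1.
Qed.

(** The term equals [a ^ n] times [(a * b)] to the power [n (n - 1) / 2]; the even exponent [c * 2]
    absorbs the halving. *)
Lemma theta_term_mono (a b : C) e x y (c n : int) :
  a = mono e x y -> b != 0 -> a * b = p ^ (c * 2) ->
  theta_term a b n = mono (e * n) (c * (n * (n - 1)) + x * n) (y * n).
Proof.
move=> aE b0 ab; have a0 : a != 0 by rewrite aE mono_neq0.
rewrite /theta_term; have -> : n * (n + 1) = n * 2 + n * (n - 1) by ring.
rewrite divzMDl // addrC expfzDr // mulrAC -expfzMl ab aE monoX expfz_exp.
have -> : c * 2 * (n * (n - 1) %/ 2)%Z = c * (n * (n - 1)).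
  rewrite -mulrA; congr (_ * _); rewrite mulrC divzK //.
  have : (2 %| n)%Z || (2 %| n - 1)%Z by lia.
  by case/orP => h; [exact: dvdz_mulr | exact: dvdz_mull].
by rewrite /signed_monomial expfzDr //; ring.
Qed.

(* The first copy of Z x Z is sent onto the pairs with even sum, the second one
   onto those with odd sum. *)
Definition sum_diff (x : int * int + int * int) : int * int :=
  match x with
  | inl (n, m) => (n + m, n - m)
  | inr (n, m) => (1 - n - m, n - m)
  end.

Definition sum_diff_inv (x : int * int) : int * int + int * int :=
  let: (u, v) := x in
  if (2 %| u + v)%Z then inl (((u + v) %/ 2)%Z, ((u - v) %/ 2)%Z)
  else inr (((1 - u + v) %/ 2)%Z, ((1 - u - v) %/ 2)%Z).

Lemma sum_diffK : cancel sum_diff sum_diff_inv.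
Proof.
case=> [[n m]|[n m]] /=.
  by rewrite ifT; [congr (inl (_, _)); lia | lia].
by rewrite ifF; [congr (inr (_, _)); lia | lia].
Qed.

Lemma sum_diff_invK : cancel sum_diff_inv sum_diff.
Proof. by case=> u v /=; case: ifP => h /=; congr (_, _); lia. Qed.

Definition diff_half_sum (x : int * int) : int * int :=
  let: (n, m) := x in
  (n - m, if (2 %| n + m)%Z then ((n + m) %/ 2)%Z else ((1 - n - m) %/ 2)%Z).

(** The parity of [u = n - m] is that of [n + m], so it tells which form, [w * 2] or [1 - w * 2],
    the sum has. *)
Definition diff_half_sum_inv (x : int * int) : int * int :=
  let: (u, w) := x in
  if (2 %| u)%Z then (((w * 2 + u) %/ 2)%Z, ((w * 2 - u) %/ 2)%Z)
  else (((1 - w * 2 + u) %/ 2)%Z, ((1 - w * 2 - u) %/ 2)%Z).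

Lemma diff_half_sumK : cancel diff_half_sum diff_half_sum_inv.
Proof.
case=> n m /=; case: ifP => h; first by rewrite ifT; [congr (_, _); lia | lia].
by rewrite ifF; [congr (_, _); lia | lia].
Qed.

Lemma diff_half_sum_invK : cancel diff_half_sum_inv diff_half_sum.
Proof.
case=> u w; rewrite /diff_half_sum_inv; case: ifP => h /=.
  by rewrite ifT; [congr (_, _); lia | lia].
by rewrite ifF; [congr (_, _); lia | lia].
Qed.

Lemma hassum_theta_prod (a b a' b' : C) : a != 0 -> b != 0 -> `|a * b| < 1 ->
  a' != 0 -> b' != 0 -> `|a' * b'| < 1 ->
  hassum (fun x : int * int => theta_term a b x.1 * theta_term a' b' x.2)
    (theta a b * theta a' b').
Proof.
move=> a0 b0 ab a0' b0' ab'.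
have [h [L hL]] := hassum_theta cC a0 b0 ab.
have [h' [L' hL']] := hassum_theta cC a0' b0' ab'.
exact: hassum_prod h h' hL hL'.
Qed.

(** * The three identities between products of theta functions *)

Local Notation thA := (theta (- (p / z)) (- (p ^+ 3 * z))).
Local Notation thB := (theta (- (p * z)) (- (p ^+ 3 / z))).

Lemma pXlt1 n : `|p ^+ n.+1| < 1.
Proof. by rewrite normrX exprn_ilt1. Qed.

Lemma termA n : theta_term (- (p / z)) (- (p ^+ 3 * z)) n =
  mono n (2 * (n * (n - 1)) + n) (- n).
Proof.
rewrite (@theta_term_mono _ _ 1 1 (-1) 2) ?mul1r ?mulN1r //.
- by rewrite /signed_monomial !expr1z mulN1r mulNr -invr_expz expr1z.
- by rewrite oppr_eq0 mulf_neq0 // expf_neq0.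
- by rewrite -[p ^ _]/(p ^+ 4); field.
Qed.

Lemma termB n : theta_term (- (p * z)) (- (p ^+ 3 / z)) n =
  mono n (2 * (n * (n - 1)) + n) n.
Proof.
rewrite (@theta_term_mono _ _ 1 1 1 2) ?mul1r //.
- by rewrite /signed_monomial !expr1z mulN1r mulNr.
- by rewrite oppr_eq0 mulf_neq0 ?invr_eq0 // expf_neq0.
- by rewrite -[p ^ _]/(p ^+ 4); field.
Qed.

Lemma term_phi n : theta_term p p n = mono 0 (n * n) 0.
Proof.
rewrite (@theta_term_mono _ _ 0 1 0 1) ?mul1r ?mul0r //.
- by apply: (eq_mono (d := 0)); ring.
- by rewrite /signed_monomial !expr0z expr1z mul1r mulr1.
Qed.

Lemma term_phiN n : theta_term (- p) (- p) n = mono n (n * n) 0.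
Proof.
rewrite (@theta_term_mono _ _ 1 1 0 1) ?mul1r ?mul0r ?oppr_eq0 //.
- by apply: (eq_mono (d := 0)); ring.
- by rewrite /signed_monomial !expr0z !expr1z mulN1r mulr1.
- by rewrite mulrNN.
Qed.

Lemma term_theta_zN n : theta_term (- z) (- (p ^+ 2 / z)) n =
  mono n (n * (n - 1)) n.
Proof.
rewrite (@theta_term_mono _ _ 1 0 1 1) ?mul1r ?mul0r ?addr0 //.
- by rewrite /signed_monomial !expr0z !expr1z mulr1 mulN1r.
- by rewrite oppr_eq0 mulf_neq0 ?invr_eq0 // expf_neq0.
- by rewrite -[p ^ _]/(p ^+ 2); field.
Qed.

Lemma term_theta_z n : theta_term z (p ^+ 2 / z) n =
  mono 0 (n * (n - 1)) n.
Proof.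
rewrite (@theta_term_mono _ _ 0 0 1 1) ?mul1r ?mul0r ?addr0 //.
- by rewrite /signed_monomial !expr0z !expr1z !mul1r.
- by rewrite mulf_neq0 ?invr_eq0 // expf_neq0.
- by rewrite -[p ^ _]/(p ^+ 2); field.
Qed.

Lemma term_theta_pz n : theta_term (- (p / z)) (- (p * z)) n =
  mono n (n * n) (- n).
Proof.
rewrite (@theta_term_mono _ _ 1 1 (-1) 1) ?mul1r ?mulN1r //.
- by apply: (eq_mono (d := 0)); ring.
- by rewrite /signed_monomial !expr1z mulN1r mulNr -invr_expz expr1z.
- by rewrite oppr_eq0 mulf_neq0.
- by rewrite -[p ^ _]/(p ^+ 2); field.
Qed.

Lemma term_psi n : theta_term (p ^+ 2) ((p ^+ 2) ^+ 3) n =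
  mono 0 (4 * (n * (n - 1)) + 2 * n) 0.
Proof.
rewrite (@theta_term_mono _ _ 0 2 0 4) ?mul0r ?expf_neq0 //.
- by rewrite /signed_monomial !expr0z mul1r mulr1.
- by rewrite -[p ^ _]/(p ^+ 8); ring.
Qed.

Lemma pz_neq0 : [/\ - (p / z) != 0, - (p ^+ 3 * z) != 0, - (p * z) != 0,
  - (p ^+ 3 / z) != 0 & p ^+ 2 / z != 0].
Proof. by split; rewrite ?oppr_eq0 mulf_neq0 ?invr_eq0 ?expf_neq0. Qed.

Lemma thetaA_lt1 : `|- (p / z) * - (p ^+ 3 * z)| < 1.
Proof. have -> : - (p / z) * - (p ^+ 3 * z) = p ^+ 4 by field. exact: pXlt1. Qed.

Lemma thetaB_lt1 : `|- (p * z) * - (p ^+ 3 / z)| < 1.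
Proof. have -> : - (p * z) * - (p ^+ 3 / z) = p ^+ 4 by field. exact: pXlt1. Qed.

Lemma theta_quotient_prod :
  thA * thB = psi (p ^+ 2) * theta (- (p / z)) (- (p * z)).
Proof.
have [n1 n2 n3 n4 n5] := pz_neq0.
have hAB := hassum_theta_prod n1 n2 thetaA_lt1 n3 n4 thetaB_lt1.
have l1 : `|- (p / z) * - (p * z)| < 1.
  have -> : - (p / z) * - (p * z) = p ^+ 2 by field. exact: pXlt1.
have l2 : `|p ^+ 2 * (p ^+ 2) ^+ 3| < 1.
  have -> : p ^+ 2 * (p ^+ 2) ^+ 3 = p ^+ 8 by ring. exact: pXlt1.
have p20 : p ^+ 2 != 0 := expf_neq0 2 p0.
have hP := hassum_theta_prod n1 n3 l1 p20 (expf_neq0 3 p20) l2.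
symmetry; rewrite mulrC; apply: hassum_unique hP _.
apply: (hassum_bij diff_half_sumK diff_half_sum_invK).
apply: eq_hassum hAB => -[n m] /=.
rewrite termA termB term_theta_pz term_psi !monoM; case: ifP => h.
  (* Eliminating [n] in favour of the half sum [k] makes all exponents polynomial. *)
  have [k hk] : exists k, n = k * 2 - m by exists ((n + m) %/ 2)%Z; lia.
  have -> : ((n + m) %/ 2)%Z = k by lia.
  by apply: (eq_mono (d := m)); rewrite hk; ring.
have [k hk] : exists k, n = 1 - k * 2 - m by exists ((1 - n - m) %/ 2)%Z; lia.
have -> : ((1 - n - m) %/ 2)%Z = k by lia.
by apply: (eq_mono (d := m)); rewrite hk; ring.
Qed.

(** Used with [c = -1] and [c = 1]. The factor [z] is absorbed into the monomials of the second
    copy, whence the exponent [1 - n - m]. *)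
Lemma hassum_quotient_sqr (c : C) :
  hassum (fun x : int * int + int * int => match x with
    | inl (n, m) => mono (n + m)
        (2 * (n * (n - 1)) + n + (2 * (m * (m - 1)) + m)) (n + m)
    | inr (n, m) => c * mono (n + m)
        (2 * (n * (n - 1)) + n + (2 * (m * (m - 1)) + m)) (1 - n - m)
    end) (thB ^+ 2 + c * z * thA ^+ 2).
Proof.
have [n1 n2 n3 n4 n5] := pz_neq0.
apply: hassum_sumtype.
  apply: eq_hassum (hassum_theta_prod n3 n4 thetaB_lt1 n3 n4 thetaB_lt1).
  by move=> [n m] /=; rewrite !termB monoM.
have hAA := hassum_theta_prod n1 n2 thetaA_lt1 n1 n2 thetaA_lt1.
apply: eq_hassum (hassumZ (c * z) hAA).
move=> [n m] /=; rewrite !termA monoM -mulrA; congr (_ * _).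
have zE : z = mono 0 0 1 by rewrite /signed_monomial !expr0z expr1z !mul1r.
rewrite [X in X * _]zE monoM; apply: (eq_mono (d := 0)); ring.
Qed.

Lemma theta_quotient_sub :
  thB ^+ 2 - z * thA ^+ 2 = phi p * theta (- z) (- (p ^+ 2 / z)).
Proof.
have [n1 n2 n3 n4 n5] := pz_neq0.
have l1 : `|- z * - (p ^+ 2 / z)| < 1.
  have -> : - z * - (p ^+ 2 / z) = p ^+ 2 by field. exact: pXlt1.
have l2 : `|p * p| < 1 by rewrite -expr2 pXlt1.
have zN0 : - z != 0 by rewrite oppr_eq0.
have n6 : - (p ^+ 2 / z) != 0 by rewrite oppr_eq0.
have hP := hassum_theta_prod zN0 n6 l1 p0 p0 l2.
have h := hassum_quotient_sqr (-1); rewrite mulN1r mulNr in h.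
rewrite [RHS]mulrC; apply: hassum_unique h _.
apply: (hassum_bij sum_diff_invK sum_diffK).
(* Writing [x] as [sum_diff] of its preimage lets the case split run over the two copies, without
   parity tests. *)
apply: eq_hassum hP => x /=; rewrite -{1 2}(sum_diff_invK x).
case: (sum_diff_inv x) => [[n m]|[n m]] /=; rewrite term_theta_zN term_phi monoM.
  by apply: (eq_mono (d := 0)); ring.
(* On the odd half the theta term has sign exponent [1 - n - m]; the extra 1 is the minus sign in
   front of [z * thA ^+ 2]. *)
have -> : -1 = mono 1 0 0 by rewrite /signed_monomial !expr0z expr1z !mulr1.
by rewrite monoM; apply: (eq_mono (d := - n - m)); ring.
Qed.

Lemma theta_quotient_add :
  thB ^+ 2 + z * thA ^+ 2 = phi (- p) * theta z (p ^+ 2 / z).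
Proof.
have [n1 n2 n3 n4 n5] := pz_neq0.
have l1 : `|z * (p ^+ 2 / z)| < 1.
  have -> : z * (p ^+ 2 / z) = p ^+ 2 by field. exact: pXlt1.
have l2 : `|- p * - p| < 1 by rewrite mulrNN -expr2 pXlt1.
have pN0 : - p != 0 by rewrite oppr_eq0.
have hP := hassum_theta_prod z0 n5 l1 pN0 pN0 l2.
have h := hassum_quotient_sqr 1; rewrite mul1r in h.
rewrite [RHS]mulrC; apply: hassum_unique h _.
apply: (hassum_bij sum_diff_invK sum_diffK).
apply: eq_hassum hP => x /=; rewrite -{1 2}(sum_diff_invK x).
case: (sum_diff_inv x) => [[n m]|[n m]] /=; rewrite term_theta_z term_phiN monoM.
  (* The sign now comes from [phi (- p)]: its exponent is [n - m] on both halves, of the same parity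
     as [n + m]. *)
  by apply: (eq_mono (d := - m)); ring.
by rewrite mul1r; apply: (eq_mono (d := - m)); ring.
Qed.

End QuotientIdentities.

(** * The quotient and the fractional powers of q *)

(** For [u = w * (A / B)] with [z = w ^+ 2], the values [1 / u - u] and [1 / u + u] have numerators
    [B ^+ 2 - z * A ^+ 2] and [B ^+ 2 + z * A ^+ 2] over [w * A * B]. The thetas [A] and [B] are
    nonzero because [num], [den] and [qpoch (p ^+ 4) (p ^+ 4)] are. *)
Lemma quotient_identities (C : numFieldType) (cC : geo_complete C) (p w : C) :
  p != 0 -> w != 0 -> `|p| < 1 ->
  let z := w ^+ 2 in
  let num := qpochs [:: p / z; p ^+ 3 * z] (p ^+ 4) in
  let den := qpochs [:: p * z; p ^+ 3 / z] (p ^+ 4) in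
  let u := w * (num / den) in
  num != 0 -> den != 0 ->
  [/\ u = w * (theta (- (p / z)) (- (p ^+ 3 * z)) /
               theta (- (p * z)) (- (p ^+ 3 / z))),
      1 / u - u = (phi p * theta (- z) (- (p ^+ 2 / z))) /
        (w * psi (p ^+ 2) * theta (- (p / z)) (- (p * z)))
    & 1 / u + u = (phi (- p) * theta z (p ^+ 2 / z)) /
        (w * psi (p ^+ 2) * theta (- (p / z)) (- (p * z)))].
Proof.
move=> p0 w0 p1 z num den u; rewrite {}/u {}/num {}/den /qpochs.
rewrite !big_cons !big_nil !mulr1.
move=> num0 den0.
have z0 : z != 0 by rewrite expf_neq0.
have p41 : `|p ^+ 4| < 1 by exact: pXlt1.
have [E0 _] := qpoch_part_bounds cC p41.
have pz0 : p / z != 0 by rewrite mulf_neq0 ?invr_eq0.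
have pz0' : p * z != 0 by rewrite mulf_neq0.
have p3z0 : p ^+ 3 * z != 0 by rewrite mulf_neq0 ?expf_neq0.
have p3z0' : p ^+ 3 / z != 0 by rewrite mulf_neq0 ?invr_eq0 ?expf_neq0.
have abA : (p / z) * (p ^+ 3 * z) = p ^+ 4 by field.
have abB : (p * z) * (p ^+ 3 / z) = p ^+ 4 by field.
have jA := jacobi_triple_product cC pz0 p3z0; rewrite abA in jA.
have jB := jacobi_triple_product cC pz0' p3z0'; rewrite abB in jB.
have A0 : theta (- (p / z)) (- (p ^+ 3 * z)) != 0 by rewrite jA // mulf_neq0.
have B0 : theta (- (p * z)) (- (p ^+ 3 / z)) != 0 by rewrite jB // mulf_neq0.
have -> : qpoch (p / z) (p ^+ 4) * qpoch (p ^+ 3 * z) (p ^+ 4) /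
    (qpoch (p * z) (p ^+ 4) * qpoch (p ^+ 3 / z) (p ^+ 4)) =
    theta (- (p / z)) (- (p ^+ 3 * z)) / theta (- (p * z)) (- (p ^+ 3 / z)).
  by rewrite jA // jB // -[in RHS]mulf_div divff // mulr1.
rewrite -(theta_quotient_sub cC p0 z0 p1) -(theta_quotient_add cC p0 z0 p1).
rewrite -!(mulrA w) -(theta_quotient_prod cC p0 z0 p1) /z.
by split=> //; field; rewrite w0 A0 B0.
Qed.

Lemma qpowE (C : numFieldType) (t : C) (e : rat) (x : int) :
  4 * e = x%:~R -> qpow t e = t ^ x.
Proof. by rewrite /qpow => ->; rewrite numq_int. Qed.

Theorem theorem1p3 (R : realType) (k m : nat) (i : rat) (q q4 : R[i])
    (k_gt0 : (0 < k)%N) (k_even : ~~ odd k)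
    (m_ge1 : (1 <= m)%N) (i_def : i = m%:R / 2)
    (q_gt0 : 0 < `|q|) (q_lt1 : `|q| < 1) (q4_root : q4 ^+ 4 = q)
    (num_neq0 : Unum q4 k i != 0) (den_neq0 : Uden q4 k i != 0) :
  [/\ U q4 k i =
        qpow q4 ((2 * i - 1) / 4) *
        (theta (- qpow q4 ((k%:R - (4 * i - 2)) / 4))
               (- qpow q4 ((3 * k%:R + (4 * i - 2)) / 4)) /
         theta (- qpow q4 ((k%:R + (4 * i - 2)) / 4))
               (- qpow q4 ((3 * k%:R - (4 * i - 2)) / 4))),
      1 / U q4 k i - U q4 k i =
        (phi (qpow q4 (k%:R / 4)) *
         theta (- qpow q4 ((2 * i - 1) / 2))
               (- qpow q4 ((k%:R - (2 * i - 1)) / 2))) /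
        (qpow q4 ((2 * i - 1) / 4) * psi (qpow q4 (k%:R / 2)) *
         theta (- qpow q4 ((k%:R - (4 * i - 2)) / 4))
               (- qpow q4 ((k%:R + (4 * i - 2)) / 4)))
    & 1 / U q4 k i + U q4 k i =
        (phi (- qpow q4 (k%:R / 4)) *
         theta (qpow q4 ((2 * i - 1) / 2))
               (qpow q4 ((k%:R - (2 * i - 1)) / 2))) /
        (qpow q4 ((2 * i - 1) / 4) * psi (qpow q4 (k%:R / 2)) *
         theta (- qpow q4 ((k%:R - (4 * i - 2)) / 4))
               (- qpow q4 ((k%:R + (4 * i - 2)) / 4)))].
Proof.
have t0 : q4 != 0.
  by apply/eqP => t0; move: q_gt0; rewrite -q4_root t0 expr0n normr0 ltxx.
have t1 : `|q4| < 1.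
  by move: q_lt1; rewrite -q4_root normrX expr_lt1.
(* Since [2 * i = m], the power of [q] with exponent [(2 * i - 1) / 4] is [q4] to the integer
   [m - 1]. *)
pose p := q4 ^+ k; pose w := q4 ^ (m%:Z - 1); pose z := w ^+ 2.
have p0 : p != 0 by rewrite expf_neq0.
have w0 : w != 0 by rewrite expfz_neq0.
have p1 : `|p| < 1 by rewrite normrX exprn_ilt1 // -lt0n.
(* Every exponent of [q4] that occurs is an integer combination of [k] and [m - 1], so every power
   is a monomial in [p] and [w]. *)
have powE (x y e : int) : e = k%:Z * x + (m%:Z - 1) * y -> q4 ^ e = p ^ x * w ^ y.
  by move=> ->; rewrite expfzDr // -!expfz_exp.
have e1 : qpow q4 ((k%:R - (4 * i - 2)) / 4) = p / z.
  rewrite (@qpowE _ _ _ (k%:Z - 2 * (m%:Z - 1))); last by rewrite i_def; field.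
  by rewrite (powE 1 (-2)); [rewrite expr1z -exprnN | ring].
have e2 : qpow q4 ((3 * k%:R + (4 * i - 2)) / 4) = p ^+ 3 * z.
  rewrite (@qpowE _ _ _ (3 * k%:Z + 2 * (m%:Z - 1))); last by rewrite i_def; field.
  by rewrite (powE 3 2) //; ring.
have e3 : qpow q4 ((k%:R + (4 * i - 2)) / 4) = p * z.
  rewrite (@qpowE _ _ _ (k%:Z + 2 * (m%:Z - 1))); last by rewrite i_def; field.
  by rewrite (powE 1 2); [rewrite expr1z | ring].
have e4 : qpow q4 ((3 * k%:R - (4 * i - 2)) / 4) = p ^+ 3 / z.
  rewrite (@qpowE _ _ _ (3 * k%:Z - 2 * (m%:Z - 1))); last by rewrite i_def; field.
  by rewrite (powE 3 (-2)); [rewrite -exprnN | ring].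
have e5 : qpow q4 k%:R = p ^+ 4.
  rewrite (@qpowE _ _ _ (4 * k%:Z)); last by ring.
  by rewrite (powE 4 0); [rewrite expr0z mulr1 | ring].
have e6 : qpow q4 ((2 * i - 1) / 4) = w.
  by rewrite (@qpowE _ _ _ (m%:Z - 1)) //; rewrite i_def; field.
have e7 : qpow q4 (k%:R / 4) = p.
  by rewrite (@qpowE _ _ _ k%:Z) //; field.
have e8 : qpow q4 ((2 * i - 1) / 2) = z.
  rewrite (@qpowE _ _ _ (2 * (m%:Z - 1))); last by rewrite i_def; field.
  by rewrite (powE 0 2); [rewrite expr0z mul1r | ring].
have e9 : qpow q4 ((k%:R - (2 * i - 1)) / 2) = p ^+ 2 / z.
  rewrite (@qpowE _ _ _ (2 * k%:Z - 2 * (m%:Z - 1))); last by rewrite i_def; field.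
  by rewrite (powE 2 (-2)); [rewrite -exprnN | ring].
have e10 : qpow q4 (k%:R / 2) = p ^+ 2.
  rewrite (@qpowE _ _ _ (2 * k%:Z)); last by field.
  by rewrite (powE 2 0); [rewrite expr0z mulr1 | ring].
move: num_neq0 den_neq0; rewrite /U /Unum /Uden e1 e2 e3 e4 e5 e6 e7 e8 e9 e10.
exact: (quotient_identities (@complex_geo_complete R) p0 w0 p1).
Qed.
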